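(* Let $F\in\mathbb{V}'$, $G\in\mathbb{Q}'$, and let $\rho>0$, with in addition $\rho>\rho_0$ if neither (A1) nor (A2) holds. Let $(u^n_{X,\rho},p^n_{X,\rho})$, $n\in\mathbb{N}=\{1,2,\dots\}$, be the iterates of the iterated penalty method with both parameters equal to $\rho$ (defined in the context). Consider the following algorithm: set $w^0_{X,\rho}:=0\in\mathbb{V}$ and, for $n\in\mathbb{N}$, define $\bar u^n_{X,\rho},w^n_{X,\rho}\in\mathbb{V}$ by $$a(\bar u^n_{X,\rho},v)+\rho(\mathcal{D}\bar u^n_{X,\rho},\mathcal{D}v)_Q=F(v)-(\mathcal{D}v,\mathcal{D}w^{n-1}_{X,\rho})_Q+n\rho\,G(\mathcal{D}v)\quad\forall v\in\mathbb{V},$$ $$w^n_{X,\rho}=w^{n-1}_{X,\rho}+\rho\,\bar u^n_{X,\rho}.$$ Then $u^n_{X,\rho}=\bar u^n_{X,\rho}$ and $p^n_{X,\rho}=\mathcal{D}w^n_{X,\rho}-n\rho\,\mathcal{R}_{\mathbb{Q}}^{-1}G$ for all $n\in\mathbb{N}$.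
   Context: Setting. $V,Q$ are real Hilbert spaces with inner products $(\cdot,\cdot)_V,(\cdot,\cdot)_Q$, norms $\|\cdot\|_V,\|\cdot\|_Q$ and duals denoted by a prime. $a:V\times V\to\mathbb{R}$ is a continuous (not necessarily symmetric) bilinear form and $\mathcal{D}:V\to Q$ is a surjective bounded linear operator. With $Z=\ker\mathcal{D}$, there is $\alpha>0$ with $\alpha\le\inf_{u\in Z}\sup_{v\in Z}\frac{a(u,v)}{\|u\|_V\|v\|_V}$ and $\alpha\le\inf_{v\in Z}\sup_{u\in Z}\frac{a(u,v)}{\|u\|_V\|v\|_V}$. Infima and suprema of quotients are over nonzero vectors. $\mathbb{V}\subset V$, $\mathbb{Q}\subset Q$ are finite-dimensional subspaces with $\mathcal{D}\mathbb{V}=\mathbb{Q}$. Let $\mathbb{Z}=\{v\in\mathbb{V}:(\mathcal{D}v,q)_Q=0\ \forall q\in\mathbb{Q}\}$ and assume $$\alpha_X:=\inf_{u\in\mathbb{Z}}\sup_{v\in\mathbb{Z}}\frac{a(u,v)}{\|u\|_V\|v\|_V}=\inf_{v\in\mathbb{Z}}\sup_{u\in\mathbb{Z}}\frac{a(u,v)}{\|u\|_V\|v\|_V}>0,\qquad \beta_X:=\inf_{q\in\mathbb{Q}}\sup_{v\in\mathbb{V}}\frac{(\mathcal{D}v,q)_Q}{\|v\|_V\|q\|_Q}>0.$$ Let $M_a:=\sup_{u,v\in V}\frac{a(u,v)}{\|u\|_V\|v\|_V}$ and $\rho_0:=\frac{(M_a+\alpha_X)(M_a+2\alpha_X)M_a}{\alpha_X^2\beta_X^2}$.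 $\mathcal{R}_{\mathbb{Q}}:\mathbb{Q}\to\mathbb{Q}'$ is the Riesz map, $(\mathcal{R}_{\mathbb{Q}}p)(q)=(p,q)_Q$. (A1) $a$ is symmetric and there is $\tilde\alpha_X>0$ with $a(u,u)\ge0$ for all $u\in\mathbb{V}$ and $a(z,z)\ge\tilde\alpha_X\|z\|_V^2$ for all $z\in\mathbb{Z}$. (A2) there is $\tilde\alpha_X>0$ with $a(u,u)\ge\tilde\alpha_X\|u\|_V^2$ for all $u\in\mathbb{V}$. Iterated penalty method with both parameters equal to $\rho$: $p^0_{X,\rho}:=0$ and for $n\ge1$, $u^n_{X,\rho}\in\mathbb{V}$, $p^n_{X,\rho}\in\mathbb{Q}$ are defined by $$a(u^n_{X,\rho},v)+\rho(\mathcal{D}u^n_{X,\rho},\mathcal{D}v)_Q=F(v)+\rho G(\mathcal{D}v)-(\mathcal{D}v,p^{n-1}_{X,\rho})_Q\quad\forall v\in\mathbb{V},$$ $$p^n_{X,\rho}=p^{n-1}_{X,\rho}+\rho(\mathcal{D}u^n_{X,\rho}-\mathcal{R}_{\mathbb{Q}}^{-1}G).$$ Under the stated assumptions on $\rho$ the linear problem with form $a(u,v)+\rho(\mathcal{D}u,\mathcal{D}v)_Q$ on $\mathbb{V}$ is uniquely solvable. *)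

(* Defs.v *)
From HB Require Import structures.
From mathcomp Require Import all_boot all_order all_algebra.
From mathcomp Require Import sesquilinear.
From mathcomp Require Import all_classical all_reals.
From mathcomp Require Import ereal topology normedtype.

Set Implicit Arguments.
Unset Strict Implicit.
Unset Printing Implicit Defensive.

Import Order.TTheory GRing.Theory Num.Theory.
Import numFieldNormedType.Exports.

Local Open Scope classical_set_scope.
Local Open Scope ring_scope.

HB.mixin Record isHilbert (R : realType) V of CompleteNormedModule R V := {
  inner : {dot V for idfun};
  normr_inner : forall v : V, `|v| ^+ 2 = inner v v
}.

#[short(type="hilbertType")]
HB.structure Definition Hilbert (R : realType) :=
  {V of isHilbert R V & CompleteNormedModule R V}.

Definition nonzero (R : realType) (V : normedModType R) (A : set V) : set V :=
  A `\ (0 : V).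

Definition finite_dim_subspace (R : realType) (V : lmodType R) (W : set V) :
    Prop :=
  exists (n : nat) (e : 'I_n -> V),
    W = range (fun c : 'I_n -> R => \sum_(i < n) c i *: e i).

(* Elements of the dual of a subspace W of V are represented by functions on V;
   only their values on W matter. *)
Definition dual_on (R : realType) (V : normedModType R) (W : set V)
    (F : V -> R) : Prop :=
  (forall (c : R) (u v : V), W u -> W v -> F (c *: u + v) = c * F u + F v) /\
  (exists C : R, forall v : V, W v -> `|F v| <= C * `|v|).

Definition riesz (R : realType) (Q : hilbertType R) (p : Q) : Q -> R :=
  fun q => inner p q.

Definition riesz_inv (R : realType) (Q : hilbertType R) (W : set Q)
    (G : Q -> R) : Q :=
  xget 0 [set r | W r /\ forall q, W q -> riesz r q = G q].

(* The values are extended reals, with infimum +oo over the empty set. *)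
Definition infsup (R : realType) (U W : normedModType R) (b : U -> W -> R)
    (A : set U) (B : set W) : \bar R :=
  ereal_inf [set ereal_sup [set (b u v / (`|u| * `|v|))%:E | v in nonzero B]
            | u in nonzero A].

Definition form_norm (R : realType) (V : normedModType R) (a : V -> V -> R) :
    \bar R :=
  ereal_sup [set (a x.1 x.2 / (`|x.1| * `|x.2|))%:E
            | x in nonzero [set: V] `*` nonzero [set: V]].

Definition ker (R : realType) (V Q : lmodType R) (D : V -> Q) : set V :=
  [set v | D v = 0].

Definition discrete_ker (R : realType) (V Q : hilbertType R) (D : V -> Q)
    (VV : set V) (QQ : set Q) : set V :=
  [set v | VV v /\ forall q, QQ q -> inner (D v) q = 0].

(* alpha = +oo happens only when the discrete kernel is {0}, so that its infimum
   is over the empty set; the value is then the limit of the formula as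
   alpha tends to +oo. *)
Definition rho0 (R : realType) (M alpha beta : \bar R) : \bar R :=
  match alpha with
  | r%:E => (M + r%:E) * (M + 2%:E * r%:E) * M / (r%:E ^+ 2 * beta ^+ 2)
  | _ => 2%:E * M / beta ^+ 2
  end%E.

Definition cond_A1 (R : realType) (V : normedModType R) (a : V -> V -> R)
    (VV ZZ : set V) : Prop :=
  (forall u v, a u v = a v u) /\
  exists alpha : R, [/\ 0 < alpha,
    forall u, VV u -> 0 <= a u u &
    forall z, ZZ z -> alpha * `|z| ^+ 2 <= a z z].

Definition cond_A2 (R : realType) (V : normedModType R) (a : V -> V -> R)
    (VV : set V) : Prop :=
  exists alpha : R, 0 < alpha /\ forall u, VV u -> alpha * `|u| ^+ 2 <= a u u.

(* u 0 is unconstrained: only u n with n >= 1 is part of the method. *)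
Definition iterated_penalty (R : realType) (V Q : hilbertType R)
    (a : V -> V -> R) (D : V -> Q) (VV : set V) (QQ : set Q)
    (F : V -> R) (G : Q -> R) (rho : R) (u : nat -> V) (p : nat -> Q) : Prop :=
  p 0%N = 0 /\
  forall n : nat,
    [/\ VV (u n.+1), QQ (p n.+1),
        forall v, VV v ->
          a (u n.+1) v + rho * inner (D (u n.+1)) (D v)
          = F v + rho * G (D v) - inner (D v) (p n) &
        p n.+1 = p n + rho *: (D (u n.+1) - riesz_inv QQ G)].

Definition primal_iterated_penalty (R : realType) (V Q : hilbertType R)
    (a : V -> V -> R) (D : V -> Q) (VV : set V)
    (F : V -> R) (G : Q -> R) (rho : R) (ubar w : nat -> V) : Prop :=
  w 0%N = 0 /\
  forall n : nat,
    [/\ VV (ubar n.+1), VV (w n.+1),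
        forall v, VV v ->
          a (ubar n.+1) v + rho * inner (D (ubar n.+1)) (D v)
          = F v - inner (D v) (D (w n)) + n.+1%:R * rho * G (D v) &
        w n.+1 = w n + rho *: ubar n.+1].

(* Main.v *)
(* By induction p^n = D w^n - n rho R^-1 G, so u^{n+1} and ubar^{n+1} solve the
   same linear problem on VV; they agree because the form
   a(u,v) + rho (Du,Dv) is injective on VV. Under (A1) or (A2) this follows by
   testing with u itself; otherwise split u along the discrete kernel and its
   orthogonal complement and use the two discrete inf-sup constants. *)
Require Import Defs.
From HB Require Import structures.
From mathcomp Require Import all_boot all_order all_algebra.
From mathcomp Require Import sesquilinear.
From mathcomp Require Import all_classical all_reals.
From mathcomp Require Import ereal topology normedtype.
From mathcomp Require Import lra.

Set Implicit Arguments.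
Unset Strict Implicit.
Unset Printing Implicit Defensive.

Import Order.TTheory GRing.Theory Num.Theory.
Import numFieldNormedType.Exports.

Local Open Scope classical_set_scope.
Local Open Scope ring_scope.

(** * The Cauchy-Schwarz inequality *)

Section InnerProduct.
Variables (R : realType) (V : hilbertType R).
Implicit Types u v : V.

Lemma innerC u v : inner u v = inner v u.
Proof. by rewrite (hermC inner) expr0 mul1r. Qed.

Lemma innerBl u v w : inner (u - v) w = inner u w - inner v w.
Proof. exact: linearBl. Qed.

Lemma innerBr u v w : inner w (u - v) = inner w u - inner w v.
Proof. exact: linearBr. Qed.

Lemma innerZr c u v : inner u (c *: v) = c * inner u v.
Proof. exact: linearZr_LR. Qed.

Lemma inner_eq0 v : inner v v = 0 -> v = 0.
Proof. by rewrite -normr_inner => /eqP; rewrite sqrf_eq0 normr_eq0 => /eqP. Qed.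

(** The squared norm of [|v| u - |u| v] is [2 |u| |v| (|u| |v| - (u, v))], and it is nonnegative. *)
Lemma inner_le_norm u v : inner u v <= `|u| * `|v|.
Proof.
have [->|v0] := eqVneq v 0; first by rewrite linear0r normr0 mulr0.
have nv : 0 < `|v| by rewrite normr_gt0.
have [->|u0] := eqVneq u 0; first by rewrite linear0l normr0 mul0r.
have nu : 0 < `|u| by rewrite normr_gt0.
have : 0 <= inner (`|v| *: u - `|u| *: v) (`|v| *: u - `|u| *: v).
  by rewrite -normr_inner sqr_ge0.
rewrite linearBl !linearBr !linearZl_LR !linearZr_LR /= -!normr_inner.
rewrite (innerC v u) => h.
have h' : 0 <= (2 * `|u| * `|v|) * (`|u| * `|v| - inner u v) by lra.
by rewrite -subr_ge0 -(pmulr_rge0 _ (_ : 0 < 2 * `|u| * `|v|)) // !mulr_gt0.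
Qed.

End InnerProduct.

(** * Functionals, Riesz representation and kernels on finite-dimensional subspaces *)

Definition linear_on (R : realType) (V : lmodType R) (W : set V) (G : V -> R) :
    Prop :=
  forall (c : R) (u v : V), W u -> W v -> G (c *: u + v) = c * G u + G v.

Section FiniteDimensionalSubspaces.
Variables (R : realType) (V : lmodType R) (W : set V).
Hypothesis W_fin : finite_dim_subspace W.

Lemma finite_dim_subspace0 : W 0.
Proof.
have [n [e ->]] := W_fin; exists (fun=> 0) => //.
by rewrite big1// => i _; rewrite scale0r.
Qed.

Lemma finite_dim_subspaceP (c : R) u v : W u -> W v -> W (c *: u + v).
Proof.
have [n [e ->]] := W_fin => -[cu _ <-] [cv _ <-].
exists (fun i => c * cu i + cv i) => //.
rewrite scaler_sumr -big_split/=; apply: eq_bigr => i _.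
by rewrite scalerDl scalerA.
Qed.

Lemma finite_dim_subspaceB u v : W u -> W v -> W (u - v).
Proof. by move=> Wu Wv; rewrite addrC -scaleN1r; exact: finite_dim_subspaceP. Qed.

Lemma linear_on_sum (G : V -> R) n (e : 'I_n -> V) (c : 'I_n -> R) :
  linear_on W G -> (forall i, W (e i)) ->
  G (\sum_(i < n) c i *: e i) = \sum_(i < n) c i * G (e i).
Proof.
move=> Glin We; have W0 := finite_dim_subspace0.
(* Membership of the partial sums in [W] is carried along, since [G] is linear only on [W]. *)
suff [] : W (\sum_(i < n) c i *: e i) /\
    G (\sum_(i < n) c i *: e i) = \sum_(i < n) c i * G (e i) by [].
apply: (big_rec2 (fun x y => W x /\ G x = y)) => [|i y x _ [Wx <-]]; last first.
  by split; [exact: finite_dim_subspaceP|rewrite Glin].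
split=> //; have := Glin 1 _ _ W0 W0.
by rewrite scale1r addr0 mul1r => h; apply: (addrI (G 0)); rewrite addr0 -h.
Qed.

Lemma finite_dim_spanning :
  exists (n : nat) (e : 'I_n -> V), (forall i, W (e i)) /\
    forall v, W v -> exists c : 'I_n -> R, v = \sum_(i < n) c i *: e i.
Proof.
have [n [e WE]] := W_fin; exists n, e; split.
  move=> i; rewrite WE; exists (fun j => (j == i)%:R) => //.
  rewrite (bigD1 i)//= eqxx scale1r big1 ?addr0// => j /negPf ->.
  by rewrite scale0r.
by move=> v; rewrite WE => -[c _ <-]; exists c.
Qed.

(* Solvability of the Gram system of the vectors D (e i): its right-hand side
   annihilates the kernel of the Gram matrix, because a coefficient vector in
   that kernel gives a combination of the D (e i) of norm zero. *)
Lemma finite_dim_riesz (Q : hilbertType R) (D : {linear V -> Q}) (G : V -> R) :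
  linear_on W G -> (forall v, W v -> D v = 0 -> G v = 0) ->
  exists2 r, W r & forall v, W v -> inner (D r) (D v) = G v.
Proof.
move=> Glin Gker; have [n [e [We span]]] := finite_dim_spanning.
have Wsum (c : 'I_n -> R) : W (\sum_(i < n) c i *: e i).
  apply: (big_ind W); first exact: finite_dim_subspace0.
    by move=> x y Wx Wy; rewrite -[x]scale1r; exact: finite_dim_subspaceP.
  move=> i _; rewrite -[_ *: _]addr0; apply: finite_dim_subspaceP => //.
  exact: finite_dim_subspace0.
have innerDsum (c d : 'I_n -> R) :
    inner (D (\sum_(i < n) c i *: e i)) (D (\sum_(j < n) d j *: e j)) =
    \sum_(j < n) (\sum_(i < n) c i * inner (D (e i)) (D (e j))) * d j.
  rewrite [X in inner _ X]linear_sum linear_sumr; apply: eq_bigr => j _ /=.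
  rewrite linearZ linearZr_LR/= mulrC; congr (_ * _).
  rewrite linear_sum linear_sumlz; apply: eq_bigr => i _.
  by rewrite linearZ linearZl_LR.
pose A : 'M[R]_n := \matrix_(i, j) inner (D (e i)) (D (e j)).
pose g : 'rV[R]_n := \row_j G (e j).
have /submxP[c gE] : (g <= A)%MS.
  rewrite submxE; apply/eqP/matrixP => i k; rewrite [RHS]mxE mxE.
  (* A column [d] of [cokermx A] satisfies [A d = 0], so [d^T A d], the squared norm of the image
     under [D] of the combination with coefficients [d], vanishes and [Gker] applies. *)
  pose d j := cokermx A j k.
  transitivity (G (\sum_(j < n) d j *: e j)).
    by rewrite linear_on_sum//; apply: eq_bigr => j _; rewrite [g i j]mxE mulrC.
  apply: Gker => //; apply: inner_eq0.
  rewrite innerDsum.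
  transitivity (\sum_(i < n) d i * (A *m cokermx A) i k); last first.
    by rewrite mulmx_coker big1// => j _; rewrite mxE mulr0.
  under eq_bigr do rewrite mulr_suml.
  rewrite exchange_big/=; apply: eq_bigr => l _.
  rewrite mxE mulr_sumr; apply: eq_bigr => j _.
  by rewrite mxE mulrA.
exists (\sum_(i < n) c 0 i *: e i) => // v /span[d ->].
rewrite innerDsum linear_on_sum//; apply: eq_bigr => j _.
rewrite mulrC; congr (_ * _).
transitivity (g 0 j); last by rewrite mxE.
by rewrite gE mxE; apply: eq_bigr => i _; rewrite mxE.
Qed.

(** With [A] the Gram matrix of the [D (e i)], the combination with coefficient row [c] is killed by
    [D] exactly when [c A = 0]; the rows of [kermx A] thus yield a spanning family. *)
Lemma finite_dim_ker (Q : hilbertType R) (D : {linear V -> Q}) :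
  finite_dim_subspace (W `&` ker D).
Proof.
have [n [e WE]] := W_fin.
pose A : 'M[R]_n := \matrix_(i, j) inner (D (e i)) (D (e j)).
pose K := kermx A.
have Dsum (c : 'rV[R]_n) :
    D (\sum_(i < n) c 0 i *: e i) = 0 <-> (c <= K)%MS.
  have cA j : (c *m A) 0 j = inner (D (\sum_(i < n) c 0 i *: e i)) (D (e j)).
    rewrite mxE linear_sum linear_sumlz; apply: eq_bigr => i _.
    by rewrite linearZ linearZl_LR mxE.
  split=> [D0|/sub_kermxP cA0].
    by apply/sub_kermxP/rowP => j; rewrite cA D0 linear0l mxE.
  apply: inner_eq0; rewrite [X in inner _ X]linear_sum linear_sumr big1// => j _.
  by rewrite linearZ linearZr_LR/= -cA cA0 mxE mulr0.
have Ksum (d : 'rV[R]_n) : \sum_(i < n) (d *m K) 0 i *: e i =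
    \sum_(j < n) d 0 j *: (\sum_(i < n) K j i *: e i).
  under [RHS]eq_bigr do rewrite scaler_sumr.
  rewrite exchange_big/=; apply: eq_bigr => i _.
  by rewrite mxE scaler_suml; apply: eq_bigr => j _; rewrite scalerA.
exists n, (fun j => \sum_(i < n) K j i *: e i); apply/seteqP; split=> [v|v].
  rewrite WE => -[[c _ <-]] /=; rewrite /ker/= => D0.
  have /submxP[d dE] : (\row_j c j <= K)%MS.
    by apply/Dsum; rewrite -[RHS]D0; congr (D _); apply: eq_bigr => i _; rewrite mxE.
  exists (fun j => d 0 j) => //; rewrite -Ksum -dE.
  by apply: eq_bigr => i _; rewrite mxE.
move=> [d _ <-]; pose d' : 'rV[R]_n := \row_j d j.
have -> : \sum_(j < n) d j *: (\sum_(i < n) K j i *: e i) =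
    \sum_(i < n) (d' *m K) 0 i *: e i.
  by rewrite Ksum; apply: eq_bigr => j _; rewrite mxE.
split; first by rewrite WE; exists (fun i => (d' *m K) 0 i).
by apply/Dsum; exact: submxMl.
Qed.

End FiniteDimensionalSubspaces.

(** [xget] falls back to 0 only if no representative exists; [finite_dim_riesz] with the identity as
    [D] supplies one. *)
Lemma riesz_invP (R : realType) (Q : hilbertType R) (W : set Q) (G : Q -> R) :
  finite_dim_subspace W -> linear_on W G ->
  forall q, W q -> inner (riesz_inv W G) q = G q.
Proof.
move=> W_fin Glin.
have Gker v : W v -> v = 0 -> G v = 0.
  move=> W0 v0; rewrite v0 in W0 *.
  have := Glin 1 _ _ W0 W0.
  by rewrite scale1r addr0 mul1r => h; apply: (addrI (G 0)); rewrite addr0 -h.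
have [r Wr rE] := finite_dim_riesz W_fin (D := idfun) Glin Gker.
rewrite /riesz_inv; case: xgetP => [x _ [_ +]|/(_ r) []]; first by [].
by split.
Qed.

(** The projection [v0] is the Riesz representative on [W] of the functional [inner v]. *)
Lemma orthogonal_projection (R : realType) (V : hilbertType R) (W : set V) :
  finite_dim_subspace W ->
  forall v, exists2 v0, W v0 & forall z, W z -> inner (v - v0) z = 0.
Proof.
move=> W_fin v.
have Glin : linear_on W (inner v).
  by move=> c x y _ _; rewrite linearDr linearZr_LR.
have [|v0 Wv0 v0E] := finite_dim_riesz W_fin (D := idfun) Glin.
  by move=> x _ /= ->; rewrite linear0r.
exists v0 => // z Wz.
by rewrite innerBl (v0E z Wz : inner v0 z = inner v z) subrr.
Qed.

(** * Inf-sup constants, the norm of the form and values of [rho0] *)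

(** The infimum is at most its value at [x]. Read backwards, a positive inf-sup constant bounds
    [|x|] by a multiple of [C]. *)
Lemma infsup_le (R : realType) (U W : normedModType R) (b : U -> W -> R)
    (A : set U) (B : set W) (x : U) (C : R) :
  A x -> x != 0 -> (forall y, B y -> b x y <= C * `|y|) ->
  (infsup b A B <= (C / `|x|)%:E)%E.
Proof.
move=> Ax x0 bC; apply: ge_ereal_inf; eexists.
  by exists x => //; split=> //; exact/eqP.
apply: ge_ereal_sup => _ [y [By /eqP y0] <-].
have nx : 0 < `|x| by rewrite normr_gt0.
have ny : 0 < `|y| by rewrite normr_gt0.
rewrite lee_fin ler_pdivrMr ?mulr_gt0// mulrA divfK ?gt_eqF//.
exact: bC.
Qed.

(** The supremum is taken without absolute value; replacing [y] by [-y] accounts for negative values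
    of [a x y]. *)
Lemma form_norm_ge (R : realType) (V : normedModType R) (a : {biscalar V}) (x y : V) :
  x != 0 -> y != 0 -> ((`|a x y| / (`|x| * `|y|))%:E <= form_norm a)%E.
Proof.
move=> /eqP x0 /eqP y0.
have h z : z <> 0 -> ((a x z / (`|x| * `|z|))%:E <= form_norm a)%E.
  by move=> z0; apply: ereal_sup_ubound; exists (x, z).
have [a0|/ltW a0] := leP 0 (a x y); first by rewrite ger0_norm//; exact: h.
rewrite ler0_norm// -(normrN y) -linearNr; apply: h.
by move=> /eqP; rewrite oppr_eq0 => /eqP.
Qed.

Lemma form_norm_bound (R : realType) (V : normedModType R) (a : {biscalar V}) (m : R) :
  form_norm a = m%:E -> forall x y, `|a x y| <= m * (`|x| * `|y|).
Proof.
move=> aE x y.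
have [->|x0] := eqVneq x 0; first by rewrite linear0l !normr0 mul0r mulr0.
have [->|y0] := eqVneq y 0; first by rewrite linear0r !normr0 !mulr0.
have := form_norm_ge a x0 y0; rewrite aE lee_fin ler_pdivrMr//.
by rewrite mulr_gt0 ?normr_gt0.
Qed.

(** Excludes an infinite form norm, since no real [rho] lies above [+oo]. *)
Lemma rho0_pinfty (R : realType) (alpha : \bar R) (beta : R) :
  (0 < alpha)%E -> 0 < beta -> rho0 +oo%E alpha beta%:E = +oo%E.
Proof.
move=> alpha0 beta0.
have ib (r : R) : 0 < r -> (+oo / r%:E = +oo :> \bar R)%E.
  by move=> r0; rewrite inver gt_eqF// mulyr gtr0_sg ?invr_gt0// mul1e.
rewrite /rho0; case: alpha alpha0 => [r||]//.
  rewrite lte_fin => r0; rewrite -!EFin_expe -!EFinM !addye//.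
  by rewrite !mulyy ib// mulr_gt0// exprn_gt0.
by move=> _; rewrite -EFin_expe mulry gtr0_sg// mul1e ib// exprn_gt0.
Qed.

Lemma rho0_fin (R : realType) (m r beta : R) : 0 < r -> 0 < beta ->
  rho0 m%:E r%:E beta%:E =
  ((m + r) * (m + 2 * r) * m / (r ^+ 2 * beta ^+ 2))%:E.
Proof.
move=> r0 b0; rewrite /rho0 -!EFin_expe -!EFinM inver gt_eqF//.
by rewrite mulr_gt0// exprn_gt0.
Qed.

(** * Injectivity of the penalised form on [VV] *)

Section DiscreteUniqueness.
Variables (R : realType) (V Q : hilbertType R).
Variables (a : {biscalar V}) (D : {linear V -> Q}) (VV : set V) (QQ : set Q).
Hypotheses (VV_fin : finite_dim_subspace VV) (DVV : D @` VV = QQ).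

(** As [D v] itself lies in [QQ], it is an admissible test element. *)
Lemma discrete_kerE : discrete_ker D VV QQ = VV `&` ker D.
Proof.
apply/seteqP; split=> v /= [Vv Dv]; split=> //.
  by apply: inner_eq0; apply: Dv; rewrite -DVV; exists v.
by move=> q _; rewrite Dv linear0l.
Qed.

(* The inf-sup constant of D also bounds D from below on the
   orthogonal complement of its kernel: writing (e1, v) = (q, D v) with q in QQ,
   one has beta |q| <= |e1| and |e1|^2 = (q, D e1). *)
Lemma infsup_orthogonal_complement (e1 : V) :
  VV e1 -> (forall z, VV z -> D z = 0 -> inner e1 z = 0) -> e1 != 0 ->
  (0 < infsup (fun q v => inner (D v) q) QQ VV)%E ->
  exists beta : R, [/\ 0 < beta,
    infsup (fun q v => inner (D v) q) QQ VV = beta%:E &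
    beta * `|e1| <= `|D e1|].
Proof.
move=> Ve1 e1_orth e1_neq0.
have lin : linear_on VV (inner e1).
  by move=> c x y _ _; rewrite linearDr linearZr_LR.
have [r Vr rE] := finite_dim_riesz VV_fin lin e1_orth.
have ne1 : 0 < `|e1| by rewrite normr_gt0.
have q0 : D r != 0.
  apply/eqP => q0; have := rE _ Ve1; rewrite q0 linear0l -normr_inner => /esym/eqP.
  by rewrite sqrf_eq0 normr_eq0 (negPf e1_neq0).
have nq : 0 < `|D r| by rewrite normr_gt0.
have : (infsup (fun q v => inner (D v) q) QQ VV <= (`|e1| / `|D r|)%:E)%E.
  apply: infsup_le => //; first by rewrite -DVV; exists r.
  by move=> v Vv; rewrite innerC rE// inner_le_norm.
(* The bound just proved rules out [+oo], and positivity rules out [-oo]. *)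
case: (infsup _ _ _) => // beta; rewrite lee_fin lte_fin => le_beta beta0.
exists beta; split=> //.
have := inner_le_norm (D r) (D e1); rewrite rE// -normr_inner => h.
rewrite ler_pdivlMr// in le_beta.
rewrite -(ler_pM2r ne1) -mulrA -expr2.
apply: (le_trans (ler_wpM2l (ltW beta0) h)).
by rewrite mulrA mulrC ler_wpM2l.
Qed.

(* Split e = e0 + e1 with e0 in the discrete kernel ZZ and e1 orthogonal to it.
   Testing with ZZ gives alpha |e0| <= M |e1|; testing with e1 gives
   rho beta^2 |e1|^2 <= M |e| |e1|, hence
   rho <= M (M + alpha) / (alpha beta^2) <= rho0 unless e1 = 0. *)
Lemma penalty_form_injective_infsup (rho : R) (alpha beta : \bar R) :
  0 < rho ->
  alpha = infsup a (discrete_ker D VV QQ) (discrete_ker D VV QQ) ->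
  (0 < alpha)%E ->
  beta = infsup (fun q v => inner (D v) q) QQ VV -> (0 < beta)%E ->
  (rho0 (form_norm a) alpha beta < rho%:E)%E ->
  forall e, VV e ->
  (forall v, VV v -> a e v + rho * inner (D e) (D v) = 0) -> e = 0.
Proof.
move=> rho_gt0 alphaE alpha_gt0 betaE beta_gt0 lt_rho e Ve eE.
rewrite discrete_kerE in alphaE.
have ZZ_fin := finite_dim_ker VV_fin D.
have [e0 [Ve0 De0] e0E] := orthogonal_projection ZZ_fin e.
set e1 := e - e0 in e0E; have ee : e = e0 + e1 by rewrite addrC subrK.
have Ve1 : VV e1 by exact: finite_dim_subspaceB.
have De1 : D e = D e1 by rewrite ee linearD De0 add0r.
(* Test elements in the kernel of [D] remove the penalty term. *)
have aZ z : VV z -> D z = 0 -> a e0 z = - a e1 z.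
  move=> Vz Dz; apply/eqP; rewrite -addr_eq0 -linearDl -ee; apply/eqP.
  by rewrite -[RHS](eE z Vz) Dz linear0r mulr0 addr0.
have [e10|e1_neq0] := eqVneq e1 0.
  apply/eqP; rewrite ee e10 addr0; apply/negP => /negP e0_neq0.
  have : (alpha <= (0 / `|e0|)%:E)%E.
    rewrite alphaE; apply: infsup_le => // z [Vz Dz].
    by rewrite aZ// e10 linear0l oppr0 mul0r.
  by rewrite mul0r leNgt alpha_gt0.
exfalso.
have ne1 : 0 < `|e1| by rewrite normr_gt0.
have e1_orth z : VV z -> D z = 0 -> inner e1 z = 0 by move=> Vz Dz; exact: e0E.
rewrite {}betaE in lt_rho beta_gt0.
have [b [b0 bE be1]] := infsup_orthogonal_complement Ve1 e1_orth e1_neq0 beta_gt0.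
rewrite {}bE {beta_gt0} in lt_rho.
have := form_norm_ge a e1_neq0 e1_neq0.
case ME : (form_norm a) lt_rho => [m||]; last 2 first.
- by rewrite rho0_pinfty.
- by [].
rewrite lee_fin => lt_rho /(le_trans _) m0.
have {}m0 : 0 <= m by apply: m0; rewrite divr_ge0// mulr_ge0.
have aM := form_norm_bound ME.
have le1 : rho * (b * `|e1|) ^+ 2 <= m * ((`|e0| + `|e1|) * `|e1|).
  have h1 : (b * `|e1|) ^+ 2 <= `|D e1| ^+ 2.
    by rewrite ler_sqr ?nnegrE ?mulr_ge0// ltW.
  apply: (le_trans (ler_wpM2l (ltW rho_gt0) h1)).
  have -> : rho * `|D e1| ^+ 2 = - a e e1.
    apply/eqP; rewrite -addr_eq0 addrC normr_inner -{1}De1; apply/eqP.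
    exact: eE.
  rewrite (le_trans (ler_norm _))// normrN (le_trans (aM _ _))//.
  by rewrite ler_wpM2l// ler_wpM2r// ee ler_normD.
(* Stated conditionally because [alpha] may still be [+oo]. *)
have le2 (r : R) : alpha = r%:E -> r * `|e0| <= m * `|e1|.
  move=> rE; have [->|e0_neq0] := eqVneq e0 0; first by rewrite normr0 mulr0 mulr_ge0.
  have : (alpha <= ((m * `|e1|) / `|e0|)%:E)%E.
    rewrite alphaE; apply: infsup_le => // z [Vz Dz].
    rewrite aZ// (le_trans (ler_norm _))// normrN (le_trans (aM _ _))//.
    by rewrite mulrA.
  by rewrite rE lee_fin ler_pdivlMr// normr_gt0.
case: alpha alphaE alpha_gt0 lt_rho le2 => [r||]// alphaE.
  rewrite lte_fin => r0; rewrite rho0_fin// lte_fin => lt_rho /(_ _ erefl) le2.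
  rewrite ltr_pdivrMr ?mulr_gt0 ?exprn_gt0// in lt_rho.
  have x2 : 0 < `|e1| ^+ 2 by rewrite exprn_gt0.
  have h1 : rho * r * b ^+ 2 * `|e1| ^+ 2 <= m * (m + r) * `|e1| ^+ 2.
    have := ler_wpM2l (ltW r0) le1.
    have := ler_wpM2l (mulr_ge0 m0 (ltW ne1)) le2.
    nra.
  rewrite ler_pM2r// in h1.
  have := ler_wpM2l (ltW r0) h1.
  (* This product is the gap between [m (m + r) (m + 2 r)], which is below [rho r^2 b^2], and the
     upper bound [m (m + r) r] of the same quantity. *)
  have : 0 <= m * (m + r) * (m + r) by rewrite !mulr_ge0// addr_ge0// ltW.
  nra.
(* Case [alpha = +oo]: [e0] must vanish, and [le1] becomes [rho b^2 <= m], against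
   [2 m < rho b^2]. *)
move=> _; rewrite /rho0 -EFin_expe -EFinM inver gt_eqF ?exprn_gt0//.
rewrite -EFinM lte_fin ltr_pdivrMr ?exprn_gt0// => lt_rho _.
have e00 : e0 = 0.
  apply/eqP/negP => /negP e0_neq0.
  have : (+oo%E <= ((m * `|e1|) / `|e0|)%:E)%E.
    rewrite alphaE; apply: infsup_le => // z [Vz Dz].
    rewrite aZ// (le_trans (ler_norm _))// normrN (le_trans (aM _ _))//.
    by rewrite mulrA.
  by [].
rewrite e00 normr0 add0r -expr2 exprMn mulrA ler_pM2r ?exprn_gt0// in le1.
lra.
Qed.

(** Tested with [e], two nonnegative terms sum to zero; hence [D e = 0], and coercivity on the
    discrete kernel applies to [e]. *)
Lemma penalty_form_injective_A1 (rho : R) :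
  0 < rho -> cond_A1 a VV (discrete_ker D VV QQ) -> forall e, VV e ->
  (forall v, VV v -> a e v + rho * inner (D e) (D v) = 0) -> e = 0.
Proof.
rewrite discrete_kerE => rho_gt0 [_ [alpha [alpha0 a_ge0 aZ]]] e Ve eE.
have := eE _ Ve; rewrite -normr_inner => /eqP.
rewrite paddr_eq0 ?a_ge0// ?mulr_ge0 ?(ltW rho_gt0)// => /andP[/eqP aee].
rewrite mulf_eq0 (gt_eqF rho_gt0)/= sqrf_eq0 normr_eq0 => /eqP De.
have := aZ e (conj Ve De); rewrite aee pmulr_rle0// => h.
by apply/eqP; rewrite -normr_eq0 -sqrf_eq0 eq_le h sqr_ge0.
Qed.

Lemma penalty_form_injective_A2 (rho : R) :
  0 < rho -> cond_A2 a VV -> forall e, VV e ->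
  (forall v, VV v -> a e v + rho * inner (D e) (D v) = 0) -> e = 0.
Proof.
move=> rho_gt0 [alpha [alpha0 aV]] e Ve eE.
have : alpha * `|e| ^+ 2 <= 0.
  rewrite (le_trans (aV _ Ve))// -(eE _ Ve) lerDl -normr_inner.
  by rewrite mulr_ge0 ?sqr_ge0 ?ltW.
rewrite pmulr_rle0// => h.
by apply/eqP; rewrite -normr_eq0 -sqrf_eq0 eq_le h sqr_ge0.
Qed.

End DiscreteUniqueness.

(** * Equivalence of the two iterations *)

Theorem lemma4p5 (R : realType) (V Q : hilbertType R)
    (a : {biscalar V}) (D : {linear V -> Q})
    (a_cont : continuous (fun x : V * V => a x.1 x.2))
    (D_cont : continuous D)
    (D_surj : forall q : Q, exists v : V, D v = q)
    (alpha : R) (alpha_gt0 : 0 < alpha)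
    (infsup_a : (alpha%:E <= infsup a (ker D) (ker D))%E)
    (infsup_a' : (alpha%:E <= infsup (fun v u => a u v) (ker D) (ker D))%E)
    (VV : set V) (QQ : set Q)
    (VV_fin : finite_dim_subspace VV) (QQ_fin : finite_dim_subspace QQ)
    (DVV : D @` VV = QQ)
    (ZZ : set V) (ZZE : ZZ = discrete_ker D VV QQ)
    (alphaX betaX : \bar R)
    (alphaXE : alphaX = infsup a ZZ ZZ)
    (alphaXE' : alphaX = infsup (fun v u => a u v) ZZ ZZ)
    (alphaX_gt0 : (0 < alphaX)%E)
    (betaXE : betaX = infsup (fun q v => inner (D v) q) QQ VV)
    (betaX_gt0 : (0 < betaX)%E)
    (F : V -> R) (hF : dual_on VV F)
    (G : Q -> R) (hG : dual_on QQ G)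
    (rho : R) (rho_gt0 : 0 < rho)
    (rho_gt : ~ (cond_A1 a VV ZZ \/ cond_A2 a VV) ->
              (rho0 (form_norm a) alphaX betaX < rho%:E)%E)
    (u : nat -> V) (p : nat -> Q)
    (hup : iterated_penalty a D VV QQ F G rho u p)
    (ubar w : nat -> V)
    (hubarw : primal_iterated_penalty a D VV F G rho ubar w) :
  forall n : nat, (1 <= n)%N ->
    u n = ubar n /\ p n = D (w n) - (n%:R * rho) *: riesz_inv QQ G.
Proof.
have injective : forall e, VV e ->
    (forall v, VV v -> a e v + rho * inner (D e) (D v) = 0) -> e = 0.
  have [[A1|A2]|nA] := pselect (cond_A1 a VV ZZ \/ cond_A2 a VV).
  - by apply: (penalty_form_injective_A1 DVV rho_gt0); rewrite -ZZE.
  - exact: penalty_form_injective_A2 rho_gt0 A2.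
  - apply: (penalty_form_injective_infsup VV_fin DVV rho_gt0 _ alphaX_gt0 betaXE) => //.
      by rewrite -ZZE.
    exact: rho_gt.
have rieszG v : VV v -> inner (D v) (riesz_inv QQ G) = G (D v).
  by move=> Vv; rewrite innerC (riesz_invP QQ_fin hG.1)// -DVV; exists v.
have [p0 upE] := hup; have [w0 uwE] := hubarw.
have step n : p n = D (w n) - (n%:R * rho) *: riesz_inv QQ G ->
    u n.+1 = ubar n.+1 /\
    p n.+1 = D (w n.+1) - (n.+1%:R * rho) *: riesz_inv QQ G.
  move=> pE; have [Vu _ uE pS] := upE n; have [Vub _ ubE wS] := uwE n.
  have uu : u n.+1 = ubar n.+1.
    apply/eqP; rewrite -subr_eq0; apply/eqP; apply: injective.
      exact: finite_dim_subspaceB.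
    move=> v Vv; rewrite linearB innerBl linearBl/=.
    (* By [pE], the term [-(D v, p n)] contributes [n rho G (D v)], which with [rho G (D v)] makes
       the factor [n + 1] of the second scheme. *)
    have := uE _ Vv; have := ubE _ Vv.
    rewrite pE innerBr innerZr rieszG// -natr1; lra.
  have DwS : D (w n.+1) = D (w n) + rho *: D (ubar n.+1).
    by rewrite wS linearD linearZ.
  split=> //; rewrite pS uu pE DwS -natr1 mulrDl mul1r.
  by rewrite scalerDr scalerDl scalerN opprD addrACA.
(* The induction starts at 0, where both sides vanish; equality of [u] and [ubar] is only available
   from index 1. *)
have pE n : p n = D (w n) - (n%:R * rho) *: riesz_inv QQ G.
  elim: n => [|n /step[]//]; by rewrite p0 w0 linear0 mul0r scale0r subr0.
by case=> // n _; exact: step.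
Qed.
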